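(* Let $H$ and $K$ be Hopf algebras with $H$ cocommutative, let $K$ be an $H$-module bialgebra via an action $\rightharpoonup$, and let $\pi:H\to K$ be a Hopf algebra crossed homomorphism with respect to $\rightharpoonup$. The derived $H$-module bialgebra structure $a\rightharpoonup_\pi x=\mathrm{ad}_{\pi(a_1)}(a_2\rightharpoonup x)$ on $K$ is consistent with the derived actions on the corresponding Lie algebras and groups as follows. (1) For $x\in P(K)$ and $a\in P(H)$, we have $a\rightharpoonup_\pi x=[\pi(a),x]+(a\rightharpoonup x)$, which is exactly the derived action of the Lie algebra $P(H)$ on $P(K)$ associated with the Lie algebra crossed homomorphism $\pi|_{P(H)}:P(H)\to P(K)$. (2) For $x\in G(K)$ and $a\in G(H)$, we have $a\rightharpoonup_\pi x=\pi(a)(a\rightharpoonup x)\pi(a)^{-1}$, which is exactly the derived action of the group $G(H)$ on $G(K)$ associated with the group crossed homomorphism $\pi|_{G(H)}:G(H)\to G(K)$.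
   Context: Everything is over a field $\mathbf{k}$ of characteristic $0$. Sweedler notation: $\Delta(a)=a_1\otimes a_2$. $P(C)=\{c:\Delta(c)=c\otimes1+1\otimes c\}$ is the Lie algebra of primitive elements and $G(C)=\{c:\Delta(c)=c\otimes c,\ \varepsilon(c)=1\}$ the group of group-like elements of a Hopf algebra $C$. $\mathrm{ad}_x y=x_1yS(x_2)$. $K$ is an $H$-module bialgebra via an algebra action $\rightharpoonup:H\to\mathrm{End}(K)$ if $a\rightharpoonup 1=\varepsilon(a)1$, $a\rightharpoonup(xy)=(a_1\rightharpoonup x)(a_2\rightharpoonup y)$, $\varepsilon_K(a\rightharpoonup x)=\varepsilon_H(a)\varepsilon_K(x)$ and $\Delta_K(a\rightharpoonup x)=(a_1\rightharpoonup x_1)\otimes(a_2\rightharpoonup x_2)$. Then $\rightharpoonup$ restricts to actions $\phi:P(H)\to\mathrm{Der}(P(K))$ and $\Phi:G(H)\to\mathrm{Aut}(G(K))$. A Hopf algebra crossed homomorphism is a coalgebra homomorphism $\pi:H\to K$ with $\pi(ab)=\pi(a_1)(a_2\rightharpoonup\pi(b))$. It restricts to a Lie algebra crossed homomorphism $P(H)\to P(K)$ and to a group crossed homomorphism $G(H)\to G(K)$ with respect to the restricted actions. Derived actions: for a Lie algebra crossed homomorphism $d:\mathfrak g\to\mathfrak h$ with respect to $\phi:\mathfrak g\to\mathrm{Der}(\mathfrak h)$ (linear, $d([x,y])=\phi(x)(d(y))-\phi(y)(d(x))+[d(x),d(y)]$), the derived action is $\phi_d(x)(u)=\phi(x)(u)+[d(x),u]$.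 For a group crossed homomorphism $D:\mathcal G\to\mathcal H$ with respect to $\Phi:\mathcal G\to\mathrm{Aut}(\mathcal H)$ (i.e. $D(gh)=D(g)\Phi(g)(D(h))$), the derived action is $\Phi_D(g)(h)=D(g)\Phi(g)(h)D(g)^{-1}$. *)

(* Defs.v *)
From HB Require Import structures.
From mathcomp Require Import all_boot all_algebra.
From mathcomp Require Import boolp.

Set Implicit Arguments.
Unset Strict Implicit.
Unset Printing Implicit Defensive.

Import GRing.Theory.
Local Open Scope ring_scope.
Local Open Scope quotient_scope.

Reserved Notation "x ⊗ y" (at level 38, left associativity).
Reserved Notation "[ 'lie' x , y ]" (at level 0, format "[ 'lie'  x ,  y ]").

Definition bilin (k : fieldType) (U V W : lmodType k) (f : U -> V -> W) : Prop :=
  (forall v, linear (f^~ v)) /\ (forall u, linear (f u)).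

Section BilinTheory.
Variables (k : fieldType) (U V W : lmodType k) (f : U -> V -> W).
Hypothesis hf : bilin f.

Lemma bilinDl v : {morph f^~ v : x y / x + y}.
Proof. by move=> x y; have := hf.1 v 1 x y; rewrite !scale1r. Qed.
Lemma bilinDr u : {morph f u : x y / x + y}.
Proof. by move=> x y; have := hf.2 u 1 x y; rewrite !scale1r. Qed.
Lemma bilin0l v : f 0 v = 0.
Proof. by apply: (addrI (f 0 v)); rewrite -bilinDl !addr0. Qed.
Lemma bilin0r u : f u 0 = 0.
Proof. by apply: (addrI (f u 0)); rewrite -bilinDr !addr0. Qed.
Lemma bilinZl a u v : f (a *: u) v = a *: f u v.
Proof. by have := hf.1 v a u 0; rewrite !addr0 bilin0l addr0. Qed.
Lemma bilinZr a u v : f u (a *: v) = a *: f u v.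
Proof. by have := hf.2 u a v 0; rewrite !addr0 bilin0r addr0. Qed.
Lemma bilinNl u v : f (- u) v = - f u v.
Proof. by rewrite -scaleN1r bilinZl scaleN1r. Qed.
Lemma bilinNr u v : f u (- v) = - f u v.
Proof. by rewrite -scaleN1r bilinZr scaleN1r. Qed.
End BilinTheory.

(* Tensor product: a sequence of pairs [(u_i, v_i)] stands for the formal sum
   of the [u_i ⊗ v_i], and two formal sums are identified when no bilinear map
   distinguishes them. *)
Section Tensor.
Variables (k : fieldType) (U V : lmodType k).

Definition tsum_eq (s t : seq (U * V)) : bool :=
  `[< forall (W : lmodType k) (f : U -> V -> W), bilin f ->
      \sum_(p <- s) f p.1 p.2 = \sum_(p <- t) f p.1 p.2 >].

Lemma tsum_eq_refl : reflexive tsum_eq.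
Proof. by move=> s; apply/asboolP. Qed.
Lemma tsum_eq_sym : symmetric tsum_eq.
Proof. by move=> s t; apply/asboolP/asboolP => h W f hf; rewrite h. Qed.
Lemma tsum_eq_trans : transitive tsum_eq.
Proof.
by move=> t s r /asboolP h1 /asboolP h2; apply/asboolP => W f hf; rewrite h1 // h2.
Qed.
Canonical tsum_equiv := EquivRel tsum_eq tsum_eq_refl tsum_eq_sym tsum_eq_trans.

Definition tensor : Type := {eq_quot tsum_eq}.
HB.instance Definition _ := Choice.on tensor.

Definition tens_class (s : seq (U * V)) : tensor := \pi_{eq_quot tsum_eq} s.
Definition tens_repr (t : tensor) : seq (U * V) :=
  repr (t : {eq_quot tsum_eq}).

(* The extension of [f] to the tensor product; it is the linear map given by
   the universal property when [f] is bilinear ([tlift_tens], [tlift_linear]),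
   and it is junk otherwise. *)
Definition tlift (W : lmodType k) (f : U -> V -> W) (t : tensor) : W :=
  \sum_(p <- tens_repr t) f p.1 p.2.

Lemma tlift_class (W : lmodType k) (f : U -> V -> W) s : bilin f ->
  tlift f (tens_class s) = \sum_(p <- s) f p.1 p.2.
Proof.
move=> hf; rewrite /tlift.
have : tens_repr (tens_class s) = s %[mod {eq_quot tsum_eq}].
  by rewrite /tens_repr reprK.
by move/eqmodP => /asboolP; apply.
Qed.

Lemma tens_reprK (t : tensor) : tens_class (tens_repr t) = t.
Proof. by rewrite /tens_class /tens_repr reprK. Qed.

Lemma tensorP (s t : tensor) :
  (forall (W : lmodType k) (f : U -> V -> W), bilin f -> tlift f s = tlift f t) ->
  s = t.
Proof.
move=> h; rewrite -(tens_reprK s) -(tens_reprK t); apply/eqmodP/asboolP.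
exact: h.
Qed.

Definition tens_zero : tensor := tens_class [::].
Definition tens_add (s t : tensor) : tensor :=
  tens_class (tens_repr s ++ tens_repr t).
Definition tens_scale (a : k) (t : tensor) : tensor :=
  tens_class [seq (a *: p.1, p.2) | p <- tens_repr t].
Definition tens_opp (t : tensor) : tensor := tens_scale (- 1) t.

Section Ops.
Variables (W : lmodType k) (f : U -> V -> W).
Hypothesis hf : bilin f.
Lemma tlift_zero : tlift f tens_zero = 0.
Proof. by rewrite tlift_class // big_nil. Qed.
Lemma tlift_add s t : tlift f (tens_add s t) = tlift f s + tlift f t.
Proof. by rewrite tlift_class // big_cat. Qed.
Lemma tlift_scale a t : tlift f (tens_scale a t) = a *: tlift f t.
Proof.
rewrite tlift_class // big_map scaler_sumr.
by apply: eq_bigr => p _; rewrite bilinZl.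
Qed.
End Ops.

Lemma tens_addA : associative tens_add.
Proof. by move=> x y z; apply: tensorP => W f hf; rewrite !tlift_add // addrA. Qed.
Lemma tens_addC : commutative tens_add.
Proof. by move=> x y; apply: tensorP => W f hf; rewrite !tlift_add // addrC. Qed.
Lemma tens_add0 : left_id tens_zero tens_add.
Proof.
by move=> x; apply: tensorP => W f hf; rewrite !tlift_add // tlift_zero // add0r.
Qed.
Lemma tens_addN : left_inverse tens_zero tens_opp tens_add.
Proof.
move=> x; apply: tensorP => W f hf.
by rewrite tlift_add // tlift_scale // tlift_zero // scaleN1r addNr.
Qed.
HB.instance Definition _ :=
  GRing.isZmodule.Build tensor tens_addA tens_addC tens_add0 tens_addN.

Lemma tens_scaleA a b v : tens_scale a (tens_scale b v) = tens_scale (a * b) v.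
Proof. by apply: tensorP => W f hf; rewrite !tlift_scale // scalerA. Qed.
Lemma tens_scale1 : left_id 1 tens_scale.
Proof. by move=> x; apply: tensorP => W f hf; rewrite !tlift_scale // scale1r. Qed.
Lemma tens_scaleDr : right_distributive tens_scale +%R.
Proof.
move=> a x y; apply: tensorP => W f hf.
by rewrite tlift_scale // !tlift_add // scalerDr !tlift_scale.
Qed.
Lemma tens_scaleDl v : {morph tens_scale^~ v : a b / a + b}.
Proof.
move=> a b; apply: tensorP => W f hf.
by rewrite tlift_scale // !tlift_add // scalerDl !tlift_scale.
Qed.
HB.instance Definition _ := GRing.Zmodule_isLmodule.Build k tensor
  tens_scaleA tens_scale1 tens_scaleDr tens_scaleDl.

Definition tens (u : U) (v : V) : tensor := tens_class [:: (u, v)].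

Lemma tlift_tens (W : lmodType k) (f : U -> V -> W) u v :
  bilin f -> tlift f (tens u v) = f u v.
Proof. by move=> hf; rewrite tlift_class // big_seq1. Qed.

Lemma tlift_linear (W : lmodType k) (f : U -> V -> W) :
  bilin f -> linear (tlift f).
Proof.
move=> hf a x y; rewrite [LHS](_ : _ = tlift f (tens_add (tens_scale a x) y)) //.
by rewrite tlift_add // tlift_scale.
Qed.

Lemma tens_bilin : bilin tens.
Proof.
split=> w a x y; apply: tensorP => W f hf; rewrite tlift_linear // !tlift_tens //.
  by rewrite bilinDl // bilinZl.
by rewrite bilinDr // bilinZr.
Qed.

Lemma tens_sumE (t : tensor) : t = \sum_(p <- tens_repr t) tens p.1 p.2.
Proof.
apply: tensorP => W f hf.
pose F := GRing.isLinear.Build k tensor W *:%R (tlift f) (tlift_linear hf).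
pose g : {linear tensor -> W} := HB.pack (tlift f) F.
rewrite -[RHS]/(g _) linear_sum; apply: eq_bigr => p _.
by rewrite -[RHS]/(tlift f _) tlift_tens.
Qed.

Lemma tensor_ind (P : tensor -> Prop) :
  P 0 -> (forall u v t, P t -> P (tens u v + t)) -> forall t, P t.
Proof.
move=> P0 PS t; rewrite (tens_sumE t).
by elim: (tens_repr t) => [|p s IH]; rewrite ?big_nil // big_cons; apply: PS.
Qed.

Section LiftTheory.
Variables (W : lmodType k) (f : U -> V -> W).
Hypothesis hf : bilin f.
Lemma tliftD s t : tlift f (s + t) = tlift f s + tlift f t.
Proof. exact: tlift_add. Qed.
Lemma tlift0 : tlift f 0 = 0.
Proof. exact: tlift_zero. Qed.
Lemma tliftZ a t : tlift f (a *: t) = a *: tlift f t.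
Proof. exact: tlift_scale. Qed.
End LiftTheory.

Lemma eq_tlift (W : lmodType k) (f g : U -> V -> W) t :
  (forall u v, f u v = g u v) -> tlift f t = tlift g t.
Proof. by move=> h; apply: eq_bigr. Qed.

End Tensor.

Notation "x ⊗ y" := (tens x y) : ring_scope.

(* [tlift (fun a1 a2 => F a1 a2) (comul a)] renders the Sweedler expression
   F(a_1, a_2); in [comulA] both sides are identified in C ⊗ (C ⊗ C). *)
HB.mixin Record isCoalgebra (k : fieldType) C of GRing.Lmodule k C := {
  comul : C -> tensor C C;
  counit : C -> k;
  comul_linear : linear comul;
  counit_linear : scalar counit;
  comulA : forall c,
    tlift (fun a b => tlift (fun a1 a2 => a1 ⊗ (a2 ⊗ b)) (comul a)) (comul c)
    = tlift (fun a b => a ⊗ comul b) (comul c);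
  counitl : forall c, tlift (fun a b => counit a *: b) (comul c) = c;
  counitr : forall c, tlift (fun a b => counit b *: a) (comul c) = c;
}.
#[short(type="coalgType")]
HB.structure Definition Coalgebra (k : fieldType) :=
  {C of isCoalgebra k C & GRing.Lmodule k C}.

Definition cocommutative (k : fieldType) (C : coalgType k) : Prop :=
  forall c : C, tlift (fun a b => b ⊗ a) (comul c) = comul c.

Definition coalgebra_hom (k : fieldType) (C D : coalgType k) (f : C -> D) : Prop :=
  [/\ linear f,
      forall c, comul (f c) = tlift (fun c1 c2 => f c1 ⊗ f c2) (comul c)
    & forall c, counit (f c) = counit c].

Definition tmul (k : fieldType) (A B : algType k) (s t : tensor A B) : tensor A B :=
  tlift (fun a b => tlift (fun a' b' => (a * a') ⊗ (b * b')) t) s.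

HB.mixin Record Coalgebra_isBialgebra (k : fieldType) A
    of Coalgebra k A & GRing.Algebra k A := {
  comulM : forall a b : A, comul (a * b) = tmul (comul a) (comul b);
  comul1 : comul (1 : A) = 1 ⊗ 1;
  counitM : forall a b : A, counit (a * b) = counit a * counit b;
  counit1 : counit (1 : A) = 1;
}.
#[short(type="bialgType")]
HB.structure Definition Bialgebra (k : fieldType) :=
  {A of Coalgebra k A & GRing.Algebra k A & Coalgebra_isBialgebra k A}.

HB.mixin Record Bialgebra_isHopf (k : fieldType) A of Bialgebra k A := {
  antipode : A -> A;
  antipode_linear : linear antipode;
  antipodel : forall a : A,
    tlift (fun a1 a2 => antipode a1 * a2) (comul a) = (counit a)%:A;
  antipoder : forall a : A,
    tlift (fun a1 a2 => a1 * antipode a2) (comul a) = (counit a)%:A;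
}.
#[short(type="hopfType")]
HB.structure Definition Hopf (k : fieldType) :=
  {A of Bialgebra k A & Bialgebra_isHopf k A}.

HB.mixin Record isLieAlgebra (k : fieldType) L of GRing.Lmodule k L := {
  lie : L -> L -> L;
  lie_bilin : bilin lie;
  liexx : forall x, lie x x = 0;
  lie_jacobi : forall x y z,
    lie x (lie y z) + lie y (lie z x) + lie z (lie x y) = 0;
}.
#[short(type="lieType")]
HB.structure Definition LieAlgebra (k : fieldType) :=
  {L of isLieAlgebra k L & GRing.Lmodule k L}.

Notation "[ 'lie' x , y ]" := (lie x y) : ring_scope.

Definition commutator (k : fieldType) (A : algType k) (x y : A) : A := x * y - y * x.

Section Primitive.
Variables (k : fieldType) (C : hopfType k).

Definition is_primitive : {pred C} := [pred c | comul c == c ⊗ 1 + 1 ⊗ c].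

Lemma primP (c : C) : reflect (comul c = c ⊗ 1 + 1 ⊗ c) (c \in is_primitive).
Proof. by rewrite inE; apply: eqP. Qed.

Lemma tlift_prim (W : lmodType k) (f : C -> C -> W) c : bilin f ->
  c \in is_primitive -> tlift f (comul c) = f c 1 + f 1 c.
Proof. by move=> hf /primP->; rewrite tliftD // !tlift_tens. Qed.

Lemma is_primitive_submod : submod_closed is_primitive.
Proof.
have ml := @comul_linear k C.
split=> [|a x y /primP hx /primP hy]; apply/primP.
  have h0 := ml (-1) 0 0; rewrite scaler0 addr0 in h0.
  by rewrite h0 scaleN1r addNr (bilin0l (tens_bilin _ _)) (bilin0r (tens_bilin _ _)) addr0.
rewrite ml hx hy (bilinDl (tens_bilin _ _)) (bilinDr (tens_bilin _ _)).
rewrite (bilinZl (tens_bilin _ _)) (bilinZr (tens_bilin _ _)) scalerDr.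
by rewrite addrACA.
Qed.
HB.instance Definition _ :=
  GRing.isSubmodClosed.Build k C is_primitive is_primitive_submod.

Record primitive := Primitive { prim_val : C; _ : prim_val \in is_primitive }.
HB.instance Definition _ := [isSub for prim_val].
HB.instance Definition _ := [Choice of primitive by <:].
HB.instance Definition _ := [SubChoice_isSubLmodule of primitive by <:].
End Primitive.
Arguments is_primitive {k} C _.

Section TmulTheory.
Variables (k : fieldType) (A B : algType k).

Lemma tmul_bilin_inner (a : A) (b : B) :
  bilin (fun (a' : A) (b' : B) => (a * a') ⊗ (b * b')).
Proof.
by split=> w c x y; rewrite mulrDr -scalerAr;
  rewrite ?(bilinDl (tens_bilin _ _)) ?(bilinDr (tens_bilin _ _))
          ?(bilinZl (tens_bilin _ _)) ?(bilinZr (tens_bilin _ _)).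
Qed.

Lemma tmul_bilin_outer (t : tensor A B) :
  bilin (fun (a : A) (b : B) => tlift (fun a' b' => (a * a') ⊗ (b * b')) t).
Proof.
split=> w c x y; elim/tensor_ind: t => [|u v t IH].
- by rewrite !tlift0 ?scaler0 ?addr0 //; apply: tmul_bilin_inner.
- rewrite !tliftD; try exact: tmul_bilin_inner.
  rewrite IH !tlift_tens; try exact: tmul_bilin_inner.
  rewrite mulrDl -scalerAl (bilinDl (tens_bilin _ _)) (bilinZl (tens_bilin _ _)).
  by rewrite scalerDr addrACA.
- by rewrite !tlift0 ?scaler0 ?addr0 //; apply: tmul_bilin_inner.
rewrite !tliftD; try exact: tmul_bilin_inner.
rewrite IH !tlift_tens; try exact: tmul_bilin_inner.
rewrite mulrDl -scalerAl (bilinDr (tens_bilin _ _)) (bilinZr (tens_bilin _ _)).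
by rewrite scalerDr addrACA.
Qed.

Lemma tmulDl (s s' t : tensor A B) : tmul (s + s') t = tmul s t + tmul s' t.
Proof. exact: tliftD (tmul_bilin_outer t) s s'. Qed.

Lemma tmul0l (t : tensor A B) : tmul 0 t = 0.
Proof. exact: tlift0 (tmul_bilin_outer t). Qed.

Lemma tmul_tensl a b (t : tensor A B) :
  tmul (a ⊗ b) t = tlift (fun a' b' => (a * a') ⊗ (b * b')) t.
Proof. exact: tlift_tens (tmul_bilin_outer t). Qed.

Lemma tmul_tens (a a' : A) (b b' : B) : tmul (a ⊗ b) (a' ⊗ b') = (a * a') ⊗ (b * b').
Proof. by rewrite tmul_tensl tlift_tens //; apply: tmul_bilin_inner. Qed.

Lemma tmulDr (s t t' : tensor A B) : tmul s (t + t') = tmul s t + tmul s t'.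
Proof.
elim/tensor_ind: s => [|u v s IH]; first by rewrite !tmul0l addr0.
rewrite !tmulDl IH !tmul_tensl tliftD; last exact: tmul_bilin_inner.
by rewrite addrACA.
Qed.

Lemma tmul0r (s : tensor A B) : tmul s 0 = 0.
Proof. by apply: (addrI (tmul s 0)); rewrite -tmulDr !addr0. Qed.

Lemma tmul1 (t : tensor A B) : tmul (1 ⊗ 1) t = t.
Proof.
elim/tensor_ind: t => [|u v t IH]; first by rewrite tmul0r.
by rewrite tmulDr tmul_tens !mul1r IH.
Qed.

Lemma tmul_tensA (a a' : A) (b b' : B) (t : tensor A B) :
  tmul (a ⊗ b) (tmul (a' ⊗ b') t) = tmul (tmul (a ⊗ b) (a' ⊗ b')) t.
Proof.
rewrite tmul_tens; elim/tensor_ind: t => [|u v t IH]; first by rewrite !tmul0r.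
by rewrite !tmulDr IH !tmul_tens !mulrA.
Qed.
End TmulTheory.


Section PrimitiveLie.
Variables (k : fieldType) (C : hopfType k).
Implicit Types x y z : primitive C.

Lemma commutator_bilin : bilin (@commutator k C).
Proof.
split=> w a x y; rewrite /commutator mulrDl mulrDr -scalerAl -scalerAr opprD addrACA.
  by rewrite -scalerBr.
by rewrite -scalerBr.
Qed.

Lemma prim_lie_subproof x y :
  commutator (prim_val x) (prim_val y) \in is_primitive C.
Proof.
have ml := @comul_linear k C.
case: x y => x /= /primP hx [y /= /primP hy]; apply/primP.
rewrite /commutator addrC -scaleN1r ml !comulM hx hy !scaleN1r.
rewrite !tmulDl !tmulDr !tmul_tens !mul1r !mulr1.
rewrite (bilinDl (tens_bilin _ _)) (bilinDr (tens_bilin _ _)).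
rewrite (bilinNl (tens_bilin _ _)) (bilinNr (tens_bilin _ _)).
set p := (x * y) ⊗ 1; set q := 1 ⊗ (x * y); set p' := (y * x) ⊗ 1.
set q' := 1 ⊗ (y * x); set r := x ⊗ y; set r' := y ⊗ x.
have -> : p' + r' + (r + q') = p' + q' + (r + r').
  by rewrite [r + q']addrC addrACA [r' + r]addrC.
have -> : p + r + (r' + q) = p + q + (r + r') by rewrite [r' + q]addrC addrACA.
by rewrite addrC opprD addrACA subrr addr0 opprD addrACA [p + _]addrC [q + _]addrC.
Qed.

Definition prim_lie x y : primitive C := Primitive (prim_lie_subproof x y).

Lemma prim_lie_bilin : bilin prim_lie.
Proof.
split=> w a x y; apply: val_inj; rewrite /= ?linearP /=.
  exact: (commutator_bilin.1 _ a (prim_val x)).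
exact: (commutator_bilin.2 _ a (prim_val x)).
Qed.

Lemma prim_liexx x : prim_lie x x = 0.
Proof. by apply: val_inj; rewrite /= /commutator subrr. Qed.

Lemma prim_lie_jacobi x y z :
  prim_lie x (prim_lie y z) + prim_lie y (prim_lie z x)
    + prim_lie z (prim_lie x y) = 0.
Proof.
apply: val_inj; rewrite /= /commutator.
move: (prim_val x) (prim_val y) (prim_val z) => {x y z} x y z.
rewrite !mulrBr !mulrBl !mulrA !opprB.
rewrite !addrA !addrNK [_ - _ + x * z * y]addrAC [_ + x * z * y]addrAC addrNK.
by rewrite [_ - _ - z * y * x]addrAC addrK addrNK subrr.
Qed.

HB.instance Definition _ := isLieAlgebra.Build k (primitive C)
  prim_lie_bilin prim_liexx prim_lie_jacobi.

Lemma val_lie (x y : primitive C) :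
  prim_val [lie x, y] = commutator (prim_val x) (prim_val y).
Proof. by []. Qed.
End PrimitiveLie.

Section Grouplike.
Variables (k : fieldType).

Definition is_grouplike (C : bialgType k) : {pred C} :=
  [pred c | (comul c == c ⊗ c) && (counit c == 1)].
Arguments is_grouplike C _ : clear implicits.

Lemma glikeP (C : bialgType k) (c : C) :
  reflect (comul c = c ⊗ c /\ counit c = 1) (c \in is_grouplike C).
Proof. by rewrite inE; apply: (iffP andP) => -[/eqP ? /eqP ?]. Qed.

Variable C : hopfType k.

Record grouplike := Grouplike { glike_val : C; _ : glike_val \in is_grouplike C }.
HB.instance Definition _ := [isSub for glike_val].
HB.instance Definition _ := [Choice of grouplike by <:].
Implicit Types g h : grouplike.

Lemma mul_antipode_bilin : bilin (fun a1 a2 : C => a1 * antipode a2).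
Proof.
split=> w a x y; first by rewrite mulrDl -scalerAl.
by rewrite antipode_linear mulrDr -scalerAr.
Qed.
Lemma antipode_mul_bilin : bilin (fun a1 a2 : C => antipode a1 * a2).
Proof.
split=> w a x y; last by rewrite mulrDr -scalerAr.
by rewrite antipode_linear mulrDl -scalerAl.
Qed.

Lemma glike_mulV (c : C) : c \in is_grouplike C -> c * antipode c = 1.
Proof.
move=> /glikeP[hc ec]; have := antipoder c.
by rewrite hc tlift_tens ?ec ?scale1r //; apply: mul_antipode_bilin.
Qed.
Lemma glike_mulVl (c : C) : c \in is_grouplike C -> antipode c * c = 1.
Proof.
move=> /glikeP[hc ec]; have := antipodel c.
by rewrite hc tlift_tens ?ec ?scale1r //; apply: antipode_mul_bilin.
Qed.

Lemma glike_one_subproof : 1 \in is_grouplike C.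
Proof. by apply/glikeP; rewrite comul1 counit1. Qed.

Lemma glike_mul_subproof g h : glike_val g * glike_val h \in is_grouplike C.
Proof.
case: g h => g /= /glikeP[hg eg] [h /= /glikeP[hh eh]]; apply/glikeP.
by rewrite comulM hg hh tmul_tens counitM eg eh mulr1.
Qed.

Lemma glike_inv_subproof g : antipode (glike_val g) \in is_grouplike C.
Proof.
case: g => g /= gP; have /glikeP[hg eg] := gP; apply/glikeP.
have gS := glike_mulV gP; have Sg := glike_mulVl gP; split; last first.
  by have := counitM g (antipode g); rewrite gS counit1 eg mul1r.
rewrite -[LHS]tmul1 -[in LHS]Sg -tmul_tens -tmul_tensA.
by rewrite -hg -comulM gS comul1 tmul_tens !mulr1.
Qed.

Definition glike_one := Grouplike glike_one_subproof.
Definition glike_mul g h := Grouplike (glike_mul_subproof g h).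
Definition glike_inv g := Grouplike (glike_inv_subproof g).

Lemma glike_mulA : associative glike_mul.
Proof. by move=> x y z; apply: val_inj; rewrite /= mulrA. Qed.
Lemma glike_mul1g : left_id glike_one glike_mul.
Proof. by move=> x; apply: val_inj; rewrite /= mul1r. Qed.
Lemma glike_mulg1 : right_id glike_one glike_mul.
Proof. by move=> x; apply: val_inj; rewrite /= mulr1. Qed.
Lemma glike_mulVg : left_inverse glike_one glike_inv glike_mul.
Proof. by case=> x hx; apply: val_inj; rewrite /= glike_mulVl. Qed.
Lemma glike_mulgV : right_inverse glike_one glike_inv glike_mul.
Proof. by case=> x hx; apply: val_inj; rewrite /= glike_mulV. Qed.
HB.instance Definition _ := isGroup.Build grouplike
  glike_mulA glike_mul1g glike_mulg1 glike_mulVg glike_mulgV.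

Lemma val_glikeM g h : glike_val (g * h)%g = glike_val g * glike_val h.
Proof. by []. Qed.
Lemma val_glike1 : glike_val 1%g = 1.
Proof. by []. Qed.
End Grouplike.
Arguments is_grouplike {k} C _.

(* Actions of a Lie algebra on a Lie algebra by derivations: Lie algebra
   homomorphisms g -> Der(h). *)
Record lie_action (k : fieldType) (g h : lieType k) := LieAction {
  lie_act :> g -> h -> h;
  lie_act_bilin : bilin lie_act;
  lie_act_der : forall x u v,
    lie_act x [lie u, v] = [lie lie_act x u, v] + [lie u, lie_act x v];
  lie_act_lie : forall x y u,
    lie_act [lie x, y] u = lie_act x (lie_act y u) - lie_act y (lie_act x u);
}.

Record lie_crossed_hom (k : fieldType) (g h : lieType k) (phi : lie_action g h) :=
  LieCrossedHom {
  lie_crossed :> g -> h;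
  lie_crossed_linear : linear lie_crossed;
  lie_crossedE : forall x y, lie_crossed [lie x, y] =
    phi x (lie_crossed y) - phi y (lie_crossed x)
    + [lie lie_crossed x, lie_crossed y];
}.

Section LieDerived.
Variables (k : fieldType) (g h : lieType k) (phi : lie_action g h).
Variable d : lie_crossed_hom phi.

Definition lie_derived_fun (x : g) (u : h) : h := phi x u + [lie d x, u].

Lemma lieDl (v : h) : {morph lie^~ v : x y / x + y}.
Proof. exact: bilinDl (@lie_bilin k h) v. Qed.
Lemma lieDr (u : h) : {morph lie u : x y / x + y}.
Proof. exact: bilinDr (@lie_bilin k h) u. Qed.
Lemma lieNl (u v : h) : [lie - u, v] = - [lie u, v].
Proof. exact: bilinNl (@lie_bilin k h) u v. Qed.
Lemma lieNr (u v : h) : [lie u, - v] = - [lie u, v].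
Proof. exact: bilinNr (@lie_bilin k h) u v. Qed.
Lemma lieC (u v : h) : [lie u, v] = - [lie v, u].
Proof.
apply/eqP; rewrite -addr_eq0; have := liexx (u + v).
by rewrite lieDl !lieDr !liexx add0r addr0 => ->.
Qed.
Lemma lieA (x u v : h) : [lie x, [lie u, v]] = [lie [lie x, u], v] + [lie u, [lie x, v]].
Proof.
have /eqP := lie_jacobi x u v.
rewrite -addrA addr_eq0 => /eqP ->; rewrite opprD addrC.
by rewrite -lieC [in X in _ + X](lieC v x) lieNr opprK.
Qed.

Lemma lie_derived_bilin : bilin lie_derived_fun.
Proof.
have pb := lie_act_bilin phi; have lb := @lie_bilin k h.
split=> w a x y; rewrite /lie_derived_fun.
  rewrite lie_crossed_linear (bilinDl pb) (bilinZl pb) lieDl (bilinZl lb).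
  by rewrite scalerDr addrACA.
by rewrite (bilinDr pb) (bilinZr pb) lieDr (bilinZr lb) scalerDr addrACA.
Qed.

Lemma lie_derived_der x u v : lie_derived_fun x [lie u, v] =
  [lie lie_derived_fun x u, v] + [lie u, lie_derived_fun x v].
Proof. by rewrite /lie_derived_fun lie_act_der lieA lieDl lieDr addrACA. Qed.

Lemma lie_derived_lie x y u : lie_derived_fun [lie x, y] u =
  lie_derived_fun x (lie_derived_fun y u) - lie_derived_fun y (lie_derived_fun x u).
Proof.
have pb := lie_act_bilin phi; rewrite /lie_derived_fun.
rewrite lie_act_lie lie_crossedE !lieDr !(bilinDr pb) !lie_act_der !lieDl lieNl.
rewrite [[lie d x, [lie d y, u]]]lieA.
set A := phi x (phi y u); set B := phi y (phi x u).
set a := [lie phi x (d y), u]; set b := [lie phi y (d x), u].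
set c := [lie d y, phi x u]; set e := [lie d x, phi y u].
set f := [lie [lie d x, d y], u]; set w := [lie d y, [lie d x, u]].
have -> : A + (a + c) + (e + (f + w)) = (A + (a + f)) + ((c + e) + w).
  by rewrite [e + _]addrCA addrA -!addrA; do 2 congr (_ + _); 
     rewrite ?addrA; congr (_ + _); rewrite -?addrA addrCA !addrA.
have -> : B + (b + e) + (c + w) = (B + b) + ((c + e) + w).
  by rewrite !addrA; congr (_ + _); rewrite addrAC.
rewrite [in RHS]opprD [RHS]addrACA subrr addr0 opprD [RHS]addrACA.
by rewrite [a + f - b]addrAC.
Qed.

Definition lie_derived : lie_action g h :=
  LieAction lie_derived_bilin lie_derived_der lie_derived_lie.
End LieDerived.

(* Actions of a group on a group by automorphisms; bijectivity of each
   [grp_act g] follows from [grp_act1] and [grp_actM]. *)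
Record grp_action (G H : groupType) := GrpAction {
  grp_act :> G -> H -> H;
  grp_act_morph : forall g, {morph grp_act g : x y / (x * y)%g};
  grp_act1 : forall x, grp_act 1%g x = x;
  grp_actM : forall g g' x, grp_act (g * g')%g x = grp_act g (grp_act g' x);
}.

Record grp_crossed_hom (G H : groupType) (Phi : grp_action G H) := GrpCrossedHom {
  grp_crossed :> G -> H;
  grp_crossedE : forall g g',
    grp_crossed (g * g')%g = (grp_crossed g * Phi g (grp_crossed g'))%g;
}.

Section GrpDerived.
Variables (G H : groupType) (Phi : grp_action G H) (D : grp_crossed_hom Phi).
Local Open Scope group_scope.

Definition grp_derived_fun (g : G) (x : H) : H := D g * Phi g x * (D g)^-1.

Lemma grp_derived_morph g : {morph grp_derived_fun g : x y / x * y}.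
Proof. by move=> x y; rewrite /grp_derived_fun grp_act_morph !mulgA mulgVK. Qed.

Lemma grp_crossed1 : D 1 = 1.
Proof.
apply: (@mulgI _ (D 1)); rewrite mulg1 -[X in _ * X](grp_act1 Phi).
by rewrite -grp_crossedE mulg1.
Qed.

Lemma grp_derived1 x : grp_derived_fun 1 x = x.
Proof. by rewrite /grp_derived_fun grp_crossed1 grp_act1 invg1 mulg1 mul1g. Qed.

Lemma grp_actV g x : Phi g x^-1 = (Phi g x)^-1.
Proof.
have P1 : Phi g 1 = 1 by apply: (@mulgI _ (Phi g 1)); rewrite -grp_act_morph !mulg1.
by apply: (@mulgI _ (Phi g x)); rewrite -grp_act_morph !mulgV P1.
Qed.

Lemma grp_derivedM g g' x :
  grp_derived_fun (g * g') x = grp_derived_fun g (grp_derived_fun g' x).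
Proof.
rewrite /grp_derived_fun grp_crossedE grp_actM !grp_act_morph grp_actV invgM.
by rewrite !mulgA.
Qed.

Definition grp_derived : grp_action G H :=
  GrpAction grp_derived_morph grp_derived1 grp_derivedM.
End GrpDerived.

Section ModuleBialgebra.
Variables (k : fieldType) (H K : bialgType k).

Record module_bialgebra (act : H -> K -> K) : Prop := ModuleBialgebra {
  mact_bilin : bilin act;
  mact_one : forall x, act 1 x = x;
  mact_comp : forall a b x, act (a * b) x = act a (act b x);
  mact1 : forall a, act a 1 = (counit a)%:A;
  mactM : forall a x y,
    act a (x * y) = tlift (fun a1 a2 => act a1 x * act a2 y) (comul a);
  mact_counit : forall a x, counit (act a x) = counit a * counit x;
  mact_comul : forall a x, comul (act a x) =
    tlift (fun a1 a2 =>
      tlift (fun x1 x2 => act a1 x1 ⊗ act a2 x2) (comul x)) (comul a);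
}.

Record hopf_crossed_hom (act : H -> K -> K) (pi : H -> K) : Prop :=
  HopfCrossedHom {
  hcross_hom : coalgebra_hom pi;
  hcrossE : forall a b,
    pi (a * b) = tlift (fun a1 a2 => pi a1 * act a2 (pi b)) (comul a);
}.
End ModuleBialgebra.

Definition ad (k : fieldType) (K : hopfType k) (x y : K) : K :=
  tlift (fun x1 x2 => x1 * y * antipode x2) (comul x).

Definition derived_act (k : fieldType) (H K : hopfType k)
    (act : H -> K -> K) (pi : H -> K) (a : H) (x : K) : K :=
  tlift (fun a1 a2 => ad (pi a1) (act a2 x)) (comul a).

Section Restriction.
Variables (k : fieldType) (H K : hopfType k).
Variables (act : H -> K -> K) (hact : module_bialgebra act).
Variables (pi : H -> K) (hpi : hopf_crossed_hom act pi).

Let actb := mact_bilin hact.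
Let tb := @tens_bilin k K K.
Let pil : linear pi. Proof. by case: (hcross_hom hpi). Qed.

Lemma prim_counit (C : hopfType k) (c : C) : c \in is_primitive C -> counit c = 0.
Proof.
move=> hc; have cb : bilin (fun a b : C => counit a *: b).
  split=> w a x y; last by rewrite scalerDr !scalerA mulrC.
  by rewrite counit_linear scalerDl scalerA.
have h : counit c *: (1 : C) = 0.
  apply: (addIr c); rewrite add0r -[RHS]counitl (tlift_prim cb hc).
  by rewrite counit1 scale1r.
by apply/eqP; move/eqP: h; rewrite scaler_eq0 oner_eq0 orbF.
Qed.

Lemma act_bilin_M x y : bilin (fun a1 a2 => act a1 x * act a2 y).
Proof.
split=> w a u v; rewrite actb.1; first by rewrite mulrDl scalerAl.
by rewrite mulrDr scalerAr.
Qed.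

Lemma act_tens_bilin a1 a2 : bilin (fun x1 x2 => act a1 x1 ⊗ act a2 x2).
Proof. by split=> w a u v; rewrite actb.2 ?tb.1 ?tb.2. Qed.

Lemma act_comul_bilin (t : tensor K K) :
  bilin (fun a1 a2 => tlift (fun x1 x2 => act a1 x1 ⊗ act a2 x2) t).
Proof.
split=> w a u v; elim/tensor_ind: t => [|p q t IH];
  rewrite ?tlift0 ?scaler0 ?addr0 ?tliftD ?IH ?tlift_tens //;
  try exact: act_tens_bilin.
  by rewrite actb.1 tb.1 scalerDr addrACA.
by rewrite actb.1 tb.2 scalerDr addrACA.
Qed.

Lemma act_prim_subproof (a : primitive H) (x : primitive K) :
  act (prim_val a) (prim_val x) \in is_primitive K.
Proof.
case: a x => a ha [x hx] /=; apply/primP; rewrite (mact_comul hact).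
rewrite (tlift_prim (act_comul_bilin _) ha) !(tlift_prim (act_tens_bilin _ _) hx).
rewrite !(mact1 hact) (prim_counit ha) !(mact_one hact) scale0r counit1 scale1r.
by rewrite (bilin0l tb) (bilin0r tb) addr0 add0r.
Qed.

Definition prim_act_fun (a : primitive H) (x : primitive K) : primitive K :=
  Primitive (act_prim_subproof a x).

Lemma prim_act_bilin : bilin prim_act_fun.
Proof.
split=> w a x y; apply: val_inj; rewrite /= ?linearP /=.
  exact: (actb.1 _ a (prim_val x)).
exact: (actb.2 _ a (prim_val x)).
Qed.

Lemma act_primM (a : primitive H) x y : act (prim_val a) (x * y) =
  act (prim_val a) x * y + x * act (prim_val a) y.
Proof.
case: a => a ha /=; rewrite (mactM hact) (tlift_prim (act_bilin_M x y) ha).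
by rewrite !(mact_one hact).
Qed.

Lemma prim_act_der a u v : prim_act_fun a [lie u, v] =
  [lie prim_act_fun a u, v] + [lie u, prim_act_fun a v].
Proof.
apply: val_inj => /=; rewrite /commutator.
rewrite (bilinDr actb) (bilinNr actb) !act_primM opprD [- _ - _]addrC.
by rewrite addrACA.
Qed.

Lemma prim_act_lie a b u : prim_act_fun [lie a, b] u =
  prim_act_fun a (prim_act_fun b u) - prim_act_fun b (prim_act_fun a u).
Proof.
apply: val_inj => /=; rewrite /commutator.
by rewrite (bilinDl actb) (bilinNl actb) !(mact_comp hact).
Qed.

Definition prim_act : lie_action (primitive H) (primitive K) :=
  LieAction prim_act_bilin prim_act_der prim_act_lie.

Lemma act_glike_subproof (a : grouplike H) (x : grouplike K) :
  act (glike_val a) (glike_val x) \in is_grouplike K.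
Proof.
case: a x => a /= /glikeP[ha ea] [x /= /glikeP[hx ex]]; apply/glikeP.
rewrite (mact_comul hact) ha (tlift_tens _ _ (act_comul_bilin _)) hx.
rewrite (tlift_tens _ _ (act_tens_bilin _ _)).
by rewrite (mact_counit hact) ea ex mulr1.
Qed.

Definition glike_act_fun (a : grouplike H) (x : grouplike K) : grouplike K :=
  Grouplike (act_glike_subproof a x).

Lemma glike_act_morph a : {morph glike_act_fun a : x y / (x * y)%g}.
Proof.
move=> x y; apply: val_inj => /=; rewrite (mactM hact).
case: a => a /= /glikeP[-> _]; by rewrite (tlift_tens _ _ (act_bilin_M _ _)).
Qed.
Lemma glike_act1 x : glike_act_fun 1%g x = x.
Proof. by apply: val_inj => /=; rewrite (mact_one hact). Qed.
Lemma glike_actM a b x :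
  glike_act_fun (a * b)%g x = glike_act_fun a (glike_act_fun b x).
Proof. by apply: val_inj => /=; rewrite (mact_comp hact). Qed.

Definition glike_act : grp_action (grouplike H) (grouplike K) :=
  GrpAction glike_act_morph glike_act1 glike_actM.

Lemma hcross_bilin y : bilin (fun a1 a2 => pi a1 * act a2 y).
Proof.
split=> w a u v; first by rewrite pil mulrDl scalerAl.
by rewrite actb.1 mulrDr scalerAr.
Qed.

Lemma pi_tens_bilin : bilin (fun c1 c2 => pi c1 ⊗ pi c2).
Proof. by split=> w a u v; rewrite pil ?tb.1 ?tb.2. Qed.

Lemma pi_glike_subproof (a : grouplike H) : pi (glike_val a) \in is_grouplike K.
Proof.
case: (hcross_hom hpi) => _ pid pie.
case: a => a /= /glikeP[ha ea]; apply/glikeP; rewrite pid pie ha.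
by rewrite (tlift_tens _ _ pi_tens_bilin).
Qed.

Definition glike_hom_fun (a : grouplike H) : grouplike K :=
  Grouplike (pi_glike_subproof a).

Lemma glike_hom_crossed a b : glike_hom_fun (a * b)%g =
  (glike_hom_fun a * glike_act a (glike_hom_fun b))%g.
Proof.
apply: val_inj => /=; rewrite (hcrossE hpi).
by case: a => a /= /glikeP[-> _]; rewrite (tlift_tens _ _ (hcross_bilin _)).
Qed.

Definition glike_hom : grp_crossed_hom glike_act := GrpCrossedHom glike_hom_crossed.

Lemma hcross1 : pi 1 = 1.
Proof. by have /(congr1 (@glike_val _ _)) /= := grp_crossed1 glike_hom. Qed.

Lemma pi_prim_subproof (a : primitive H) : pi (prim_val a) \in is_primitive K.
Proof.
case: (hcross_hom hpi) => _ pid pie.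
case: a => a /= ha; apply/primP; rewrite pid.
by rewrite (tlift_prim pi_tens_bilin ha) hcross1.
Qed.

Definition prim_hom_fun (a : primitive H) : primitive K :=
  Primitive (pi_prim_subproof a).

Lemma prim_hom_linear : linear prim_hom_fun.
Proof. by move=> a x y; apply: val_inj; rewrite /= pil. Qed.

Lemma prim_hom_crossed a b : prim_hom_fun [lie a, b] =
  prim_act a (prim_hom_fun b) - prim_act b (prim_hom_fun a)
  + [lie prim_hom_fun a, prim_hom_fun b].
Proof.
apply: val_inj => /=; rewrite /commutator addrC -scaleN1r pil scaleN1r.
case: a b => a ha [b hb] /=; rewrite !(hcrossE hpi).
rewrite !(tlift_prim (hcross_bilin _)) //= hcross1 !mul1r !(mact_one hact).
by rewrite addrC opprD addrACA addrC.
Qed.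

Definition prim_hom : lie_crossed_hom prim_act :=
  LieCrossedHom prim_hom_linear prim_hom_crossed.
End Restriction.

(* Main.v *)
Require Import Defs.
From HB Require Import structures.
From mathcomp Require Import all_boot all_algebra.

Set Implicit Arguments.
Unset Strict Implicit.
Unset Printing Implicit Defensive.

Import GRing.Theory.
Local Open Scope ring_scope.

(** Write f_x(a) = a ⇀ x, and * for the convolution product
    (f * g)(a) = f(a_1) g(a_2) on linear maps H -> K.  The map σ = S ∘ π is the
    two-sided convolution inverse of π, because π is a coalgebra homomorphism, and
    cocommutativity of H puts the derived action in the form
    a ⇀_π x = (π * f_x * σ)(a) ([derived_actE]).  The module bialgebra axioms
    for it then become identities in convolution algebras.

    - Since f_{xy} = f_x * f_y, one has
      π * f_{xy} * σ = (π * f_x * σ) * (π * f_y * σ): the inner σ * π cancels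
      ([derivedM]).
    - Uniqueness of convolution inverses in Hom(H, K ⊗ K) gives
      Δσ(a) = σ(a_1) ⊗ σ(a_2) ([comul_cross_inv]).  So Δ sends π * f_x * σ to a
      product of three maps with diagonal coproducts, and the middle four
      interchange for a cocommutative coalgebra ([convACA]) sorts the factors
      ([derived_comul]).
    - Uniqueness of convolution inverses in Hom(H ⊗ H, K) gives
      σ(ab) = (a_1 ⇀ σ(b)) σ(a_2) ([cross_inv_mul]), the counterpart for σ of the
      crossed homomorphism rule for π.  Expanding π * f_x * σ at ab by the two
      rules produces a ⇀_π (b ⇀_π x) ([derived_comp]).

    The comparison with the Lie algebra and group actions is the evaluation of
    π * f_x * σ at a primitive a, where convolution is the Leibniz rule and
    σ(a) = - π(a), and at a group-like a, where convolution is pointwise and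
    σ(a) = π(a)^-1. *)

(** * Linear and bilinear maps on tensors *)

Section Linearity.
Variable k : fieldType.
Implicit Types U V W X Y Z T R S : lmodType k.

Lemma linear_scaleE U V (f : U -> V) (hf : linear f) a u : f (a *: u) = a *: f u.
Proof.
have f0 : f 0 = 0 by have := hf (-1) 0 0; rewrite scaler0 addr0 scaleN1r addNr.
by have := hf a u 0; rewrite f0 !addr0.
Qed.

(** By definition [tlift] is a finite sum over a representative of the tensor, and
    linear maps preserve sums. *)
Lemma linear_tlift U V W X (g : W -> X) (f : U -> V -> W) (t : tensor U V) :
  linear g -> g (tlift f t) = tlift (fun u v => g (f u v)) t.
Proof.
move=> hg; pose G : {linear W -> X} := HB.pack g (GRing.isLinear.Build _ _ _ _ g hg).
exact: (linear_sum G).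
Qed.

Lemma tlift_exchange U V U' V' W (F : U -> V -> U' -> V' -> W)
    (s : tensor U V) (t : tensor U' V') :
  tlift (fun u v => tlift (fun u' v' => F u v u' v') t) s
  = tlift (fun u' v' => tlift (fun u v => F u v u' v') s) t.
Proof. exact: exchange_big. Qed.

(** Linearity in a parameter of the integrand, as opposed to linearity in the
    tensor ([tlift_linear]). *)
Lemma tlift_values_linear X U V W (F : X -> U -> V -> W) (t : tensor U V) :
  (forall u v, linear (fun x => F x u v)) -> linear (fun x => tlift (F x) t).
Proof.
move=> hF a x y; rewrite /tlift scaler_sumr -big_split.
by apply: eq_bigr => p _; apply: hF.
Qed.

Lemma bilin_comp U V U' V' W (m : U -> V -> W) (f : U' -> U) (g : V' -> V) :
  bilin m -> linear f -> linear g -> bilin (fun u v => m (f u) (g v)).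
Proof. by move=> hm hf hg; split=> w a x y; rewrite ?hf ?hg ?hm.1 ?hm.2. Qed.

Lemma linear_comp U V W (f : V -> W) (g : U -> V) :
  linear f -> linear g -> linear (fun u => f (g u)).
Proof. by move=> hf hg a x y; rewrite hg hf. Qed.

Lemma linearZ_scalar U (f : U -> k) W (w : W) :
  scalar f -> linear (fun u => f u *: w).
Proof. by move=> hf a x y; rewrite hf scalerDl scalerA. Qed.

Lemma mul_bilin (A : algType k) : bilin (fun x y : A => x * y).
Proof. by split=> w a x y; rewrite ?mulrDl ?mulrDr -?scalerAl -?scalerAr. Qed.

Lemma tmul_bilin (A B : algType k) : bilin (@tmul k A B).
Proof.
split=> [t|s]; first exact: tlift_linear (tmul_bilin_outer t).
apply: (@tlift_values_linear _ _ _ _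
  (fun t a b => tlift (fun a' b' => (a * a') ⊗ (b * b')) t)) => a b.
exact: tlift_linear (tmul_bilin_inner a b).
Qed.

Lemma tmulA (A B : algType k) : associative (@tmul k A B).
Proof.
move=> r s t; elim/tensor_ind: r => [|u v r IH]; first by rewrite !tmul0l.
rewrite !tmulDl IH; congr (_ + _).
elim/tensor_ind: s {IH} => [|u' v' s IHs]; first by rewrite !(tmul0l, tmul0r).
by rewrite tmulDr !tmulDl tmulDr IHs tmul_tensA.
Qed.

Lemma tmulr1 (A B : algType k) (t : tensor A B) : tmul t (1 ⊗ 1) = t.
Proof.
elim/tensor_ind: t => [|u v t IH]; first by rewrite tmul0l.
by rewrite tmulDl tmul_tens !mulr1 IH.
Qed.
End Linearity.

(** * Convolution *)

Section Convolution.
Variables (k : fieldType) (C : coalgType k).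
Implicit Types U V W X Y Z T R S : lmodType k.

(** The coassociativity axiom only identifies two elements of C ⊗ (C ⊗ C);
    evaluating the trilinear [F] on them gives the equality of Sweedler sums. *)
Lemma sweedlerA W (F : C -> C -> C -> W) c :
  (forall z, bilin (fun x y => F x y z)) -> (forall x, bilin (F x)) ->
  tlift (fun u z => tlift (fun x y => F x y z) (comul u)) (comul c)
  = tlift (fun x v => tlift (F x) (comul v)) (comul c).
Proof.
move=> h1 h2.
have hT : bilin (fun x t => tlift (F x) t).
  split=> [t|x]; last exact: tlift_linear (h2 x).
  by apply: tlift_values_linear => y z; apply: (h1 z).1.
have := congr1 (tlift (fun x t => tlift (F x) t)) (comulA c).
rewrite !(linear_tlift _ _ (tlift_linear hT)).
rewrite [X in _ = X](eq_tlift (g := fun x v => tlift (F x) (comul v))); last first.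
  by move=> x v; rewrite (tlift_tens _ _ hT).
move=> <-; apply: eq_tlift => u z; rewrite (linear_tlift _ _ (tlift_linear hT)).
by apply: eq_tlift => x y; rewrite (tlift_tens _ _ hT) (tlift_tens _ _ (h2 x)).
Qed.

(** The product [m] is an arbitrary pairing of two possibly different modules, so
    that one theory serves products in K, products in K ⊗ K, and the maps
    a |-> f(a_1) ⊗ g(a_2), where [m] is [tens]. *)
Definition conv U V W (m : U -> V -> W) (f : C -> U) (g : C -> V) (c : C) : W :=
  tlift (fun x y => m (f x) (g y)) (comul c).

Lemma eq_conv U V W (m m' : U -> V -> W) f f' g g' c :
  (forall u v, m u v = m' u v) -> f =1 f' -> g =1 g' ->
  conv m f g c = conv m' f' g' c.
Proof. by move=> hm hf hg; apply: eq_tlift => x y; rewrite hm hf hg. Qed.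

Lemma conv_linear U V W (m : U -> V -> W) f g :
  bilin m -> linear f -> linear g -> linear (conv m f g).
Proof.
move=> hm hf hg; apply: linear_comp (@comul_linear k C).
exact: tlift_linear (bilin_comp hm hf hg).
Qed.

Lemma linear_conv U V W X (h : W -> X) (m : U -> V -> W) f g c : linear h ->
  h (conv m f g c) = conv (fun u v => h (m u v)) f g c.
Proof. exact: linear_tlift. Qed.

Lemma convA U V W X Y Z (m : X -> W -> Z) (n : U -> V -> X)
    (m' : U -> Y -> Z) (n' : V -> W -> Y) f g h c :
  bilin m -> bilin n -> bilin m' -> bilin n' ->
  linear f -> linear g -> linear h ->
  (forall u v w, m (n u v) w = m' u (n' v w)) ->
  conv m (conv n f g) h c = conv m' f (conv n' g h) c.
Proof.
move=> hm hn hm' hn' hf hg hh e.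
pose F x y z := m (n (f x) (g y)) (h z).
have F1 z : bilin (fun x y => F x y z).
  have [n1 n2] := bilin_comp hn hf hg.
  split=> [y|x]; first exact: linear_comp (hm.1 (h z)) (n1 y).
  exact: linear_comp (hm.1 (h z)) (n2 x).
have F2 x : bilin (F x).
  exact: (bilin_comp hm (linear_comp (hn.2 (f x)) hg) hh).
transitivity (tlift (fun u z => tlift (fun x y => F x y z) (comul u)) (comul c)).
  by apply: eq_tlift => u z; rewrite -(linear_tlift _ _ (hm.1 (h z))).
rewrite sweedlerA //; apply: eq_tlift => x v.
rewrite (linear_tlift _ _ (hm'.2 (f x))).
by apply: eq_tlift => y z; rewrite /F e.
Qed.

Lemma conv_counitl U V (m : U -> V -> V) (e : U) g c :
  bilin m -> linear g -> (forall v, m e v = v) ->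
  conv m (fun x => counit x *: e) g c = g c.
Proof.
move=> hm hg he; rewrite -[in RHS](counitl c) (linear_tlift _ _ hg).
apply: eq_tlift => x y.
by rewrite (bilinZl hm) he (linear_scaleE hg).
Qed.

Lemma conv_counitr U V (m : U -> V -> U) (e : V) f c :
  bilin m -> linear f -> (forall u, m u e = u) ->
  conv m f (fun x => counit x *: e) c = f c.
Proof.
move=> hm hf he; rewrite -[in RHS](counitr c) (linear_tlift _ _ hf).
apply: eq_tlift => x y.
by rewrite (bilinZr hm) he (linear_scaleE hf).
Qed.

(** A left inverse and a right inverse of [g] coincide.  The algebra structure is
    the explicit pair [m], [e] because the lemma is used for [tmul] on K ⊗ K. *)
Lemma conv_inv_unique W (m : W -> W -> W) (e : W) f g h :
  bilin m -> associative m -> left_id e m -> right_id e m ->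
  linear f -> linear g -> linear h ->
  (forall c, conv m f g c = counit c *: e) ->
  (forall c, conv m g h c = counit c *: e) -> f =1 h.
Proof.
move=> hm mA m1 m1r hf hg hh fg gh c.
rewrite -(conv_counitr (e := e) c hm hf m1r) -(conv_counitl (e := e) c hm hh m1).
transitivity (conv m f (conv m g h) c); first by apply: eq_conv.
rewrite -(convA (m := m) (n := m)) //; exact: eq_conv.
Qed.

Lemma conv_tliftl X Y U V W (m : U -> V -> W) (F : X -> Y -> C -> U) g
    (t : tensor X Y) c :
  bilin m -> conv m (fun z => tlift (fun x y => F x y z) t) g c
             = tlift (fun x y => conv m (F x y) g c) t.
Proof.
move=> hm; rewrite /conv tlift_exchange; apply: eq_tlift => x y.
by rewrite (linear_tlift _ _ (hm.1 _)).
Qed.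

Lemma conv_tliftr X Y U V W (m : U -> V -> W) f (G : X -> Y -> C -> V)
    (t : tensor X Y) c :
  bilin m -> conv m f (fun z => tlift (fun x y => G x y z) t) c
             = tlift (fun x y => conv m f (G x y) c) t.
Proof.
move=> hm; rewrite /conv tlift_exchange; apply: eq_tlift => x y.
by rewrite (linear_tlift _ _ (hm.2 _)).
Qed.

Section Cocommutative.
Hypothesis cocomC : cocommutative C.

Lemma sweedlerC W (F : C -> C -> W) c :
  bilin F -> tlift F (comul c) = tlift (fun x y => F y x) (comul c).
Proof.
move=> hF; rewrite -{1}(cocomC c) (linear_tlift _ _ (tlift_linear hF)).
by apply: eq_tlift => x y; rewrite (tlift_tens _ _ hF).
Qed.

(** The last two of three Sweedler factors trade places: reassociate so that they
    come from one coproduct, which is symmetric. *)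
Lemma sweedler_rotate W (F : C -> C -> C -> W) c :
  (forall z, bilin (fun x y => F x y z)) -> (forall x, bilin (F x)) ->
  (forall y, bilin (fun x z => F x y z)) ->
  tlift (fun u z => tlift (fun x y => F x y z) (comul u)) (comul c)
  = tlift (fun u y => tlift (fun x z => F x y z) (comul u)) (comul c).
Proof.
move=> h1 h2 h3; rewrite sweedlerA //.
rewrite (sweedlerA (F := fun x z y => F x y z)) //; last first.
  by move=> x; have [? ?] := h2 x; split.
by apply: eq_tlift => x v; apply: sweedlerC.
Qed.

(** The comultiplication of a cocommutative coalgebra is itself a coalgebra
    homomorphism. *)
Lemma sweedlerACA W (F : C -> C -> C -> C -> W) c :
  (forall y z w, linear (fun x => F x y z w)) ->
  (forall x z w, linear (fun y => F x y z w)) ->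
  (forall x y w, linear (fun z => F x y z w)) ->
  (forall x y z, linear (fun w => F x y z w)) ->
  tlift (fun u v => tlift (fun x y => tlift (F x y) (comul v)) (comul u)) (comul c)
  = tlift (fun u v =>
      tlift (fun x z => tlift (fun y w => F x y z w) (comul v)) (comul u)) (comul c).
Proof.
move=> Fx Fy Fz Fw.
(* In left-nested form, [sweedler_rotate] applied below the outermost coproduct
   exchanges [y] and [z]. *)
have collect (G : C -> C -> C -> C -> W) :
    (forall y z w, linear (fun x => G x y z w)) ->
    (forall x z w, linear (fun y => G x y z w)) ->
    (forall x y w, linear (fun z => G x y z w)) ->
    (forall x y z, linear (fun w => G x y z w)) ->
  tlift (fun u v => tlift (fun x y => tlift (G x y) (comul v)) (comul u)) (comul c)
  = tlift (fun t w => tlift (fun u z => tlift (fun x y => G x y z w) (comul u))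
      (comul t)) (comul c).
  move=> Gx Gy Gz Gw.
  have inner z w : linear (fun u => tlift (fun x y => G x y z w) (comul u)).
    by apply: linear_comp (@comul_linear k C); apply: tlift_linear; split.
  rewrite (sweedlerA (F := fun u z w => tlift (fun x y => G x y z w) (comul u)));
    first by apply: eq_tlift => u v; rewrite tlift_exchange.
  - move=> w; split=> [z|u]; first exact: inner.
    exact: (@tlift_values_linear _ _ _ _ _ (fun z x y => G x y z w)).
  - move=> u; split=> [w|z].
      exact: (@tlift_values_linear _ _ _ _ _ (fun z x y => G x y z w)).
    exact: (@tlift_values_linear _ _ _ _ _ (fun w x y => G x y z w)).
rewrite !collect //; apply: eq_tlift => t w.
exact: (sweedler_rotate (F := fun x y z => F x y z w)).
Qed.

(** Middle four interchange.  With [n], [n'] and [m'] equal to [tens], it says that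
    a |-> f(a_1) ⊗ g(a_2) is multiplicative for convolution. *)
Lemma convACA U V W X Y Z T R S (m : X -> Y -> Z) (n : U -> V -> X)
    (n' : W -> T -> Y) (m' : R -> S -> Z) (p : U -> W -> R) (p' : V -> T -> S)
    f g f' g' c :
  bilin m -> bilin n -> bilin n' -> bilin m' ->
  linear f -> linear g -> linear f' -> linear g' ->
  (forall u v w t, m (n u v) (n' w t) = m' (p u w) (p' v t)) ->
  conv m (conv n f g) (conv n' f' g') c = conv m' (conv p f f') (conv p' g g') c.
Proof.
move=> hm hn hn' hm' hf hg hf' hg' e.
pose F x y z w := m (n (f x) (g y)) (n' (f' z) (g' w)).
transitivity (tlift (fun u v =>
    tlift (fun x y => tlift (F x y) (comul v)) (comul u)) (comul c)).
  apply: eq_tlift => u v; rewrite (linear_tlift _ _ (hm.1 _)).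
  by apply: eq_tlift => x y; rewrite (linear_tlift _ _ (hm.2 _)).
rewrite sweedlerACA.
- apply: eq_tlift => u v; rewrite (linear_tlift _ _ (hm'.1 _)).
  apply: eq_tlift => x z; rewrite (linear_tlift _ _ (hm'.2 _)).
  by apply: eq_tlift => y w; rewrite /F e.
- by move=> y z w; apply: linear_comp (hm.1 _) (linear_comp (hn.1 _) hf).
- by move=> x z w; apply: linear_comp (hm.1 _) (linear_comp (hn.2 _) hg).
- by move=> x y w; apply: linear_comp (hm.2 _) (linear_comp (hn'.1 _) hf').
- by move=> x y z; apply: linear_comp (hm.2 _) (linear_comp (hn'.2 _) hg').
Qed.

End Cocommutative.
End Convolution.

(** * Convolution on products, group-likes and primitives *)

Section ConvolutionBialgebra.
Variables (k : fieldType) (C : bialgType k).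

Lemma tlift_comulM (W : lmodType k) (F : C -> C -> W) a b : bilin F ->
  tlift F (comul (a * b))
  = tlift (fun b1 b2 => tlift (fun a1 a2 => F (a1 * b1) (a2 * b2)) (comul a))
      (comul b).
Proof.
move=> hF; rewrite comulM /tmul (linear_tlift _ _ (tlift_linear hF)).
rewrite tlift_exchange; apply: eq_tlift => a1 a2.
rewrite (linear_tlift _ _ (tlift_linear hF)).
by apply: eq_tlift => b1 b2; rewrite (tlift_tens _ _ hF).
Qed.

Lemma conv_mulr (U V W : lmodType k) (m : U -> V -> W) (f : C -> U) (g : C -> V) a b :
  bilin m -> linear f -> linear g ->
  conv m f g (a * b)
  = tlift (fun b1 b2 => conv m (fun x => f (x * b1)) (fun x => g (x * b2)) a) (comul b).
Proof. by move=> hm hf hg; rewrite /conv tlift_comulM //; apply: bilin_comp. Qed.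

Lemma conv_glike (U V W : lmodType k) (m : U -> V -> W) (f : C -> U) (g : C -> V) a :
  bilin m -> linear f -> linear g -> a \in is_grouplike C ->
  conv m f g a = m (f a) (g a).
Proof.
by move=> hm hf hg /glikeP[e _]; rewrite /conv e tlift_tens //; apply: bilin_comp.
Qed.
End ConvolutionBialgebra.

Section PrimitiveElements.
Variables (k : fieldType) (C : hopfType k).

Lemma antipode1 : antipode (1 : C) = 1.
Proof. by rewrite -[LHS]mul1r (glike_mulV (glike_one_subproof C)). Qed.

Lemma antipode_prim (c : C) : c \in is_primitive C -> antipode c = - c.
Proof.
move=> hc; have := antipoder c.
rewrite (tlift_prim (mul_antipode_bilin C) hc) (prim_counit hc) scale0r.
by rewrite antipode1 mulr1 mul1r => /eqP; rewrite addrC addr_eq0 => /eqP.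
Qed.

Lemma conv_prim (U V W : lmodType k) (m : U -> V -> W) (f : C -> U) (g : C -> V) c :
  bilin m -> linear f -> linear g -> c \in is_primitive C ->
  conv m f g c = m (f c) (g 1) + m (f 1) (g c).
Proof. by move=> hm hf hg hc; rewrite /conv tlift_prim //; apply: bilin_comp. Qed.
End PrimitiveElements.

(** * The derived module bialgebra *)

Section Derived.
Variables (k : fieldType) (H K : hopfType k) (cocomH : cocommutative H).
Variables (act : H -> K -> K) (hact : module_bialgebra act).
Variables (pi : H -> K) (hpi : hopf_crossed_hom act pi).

Local Notation "f \* g" := (conv *%R f g) (at level 40, left associativity).
Local Notation orb y := (act^~ y).

(** The convolution inverse of [pi]. *)
Definition cross_inv (a : H) : K := antipode (pi a).
Local Notation sigma := cross_inv.

Let mb : bilin ( *%R : K -> K -> K) := @mul_bilin k K.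
Let tb := @tens_bilin k K K.
Let tmb := @tmul_bilin k K K.
Let pil : linear pi. Proof. by case: (hcross_hom hpi). Qed.
Let sl : linear sigma. Proof. exact: linear_comp (@antipode_linear k K) pil. Qed.
Let actl y : linear (orb y). Proof. exact: (mact_bilin hact).1. Qed.
Let actr a : linear (act a). Proof. exact: (mact_bilin hact).2. Qed.
Let convl (f g : H -> K) : linear f -> linear g -> linear (f \* g).
Proof. exact: conv_linear. Qed.
Let unitl : linear (fun a : H => counit a *: (1 : K)).
Proof. exact: (linearZ_scalar _ (@counit_linear k H)). Qed.
Let mulbl (b : H) : linear (fun a : H => a * b). Proof. exact: (@mul_bilin k H).1. Qed.

Lemma tlift_comul_pi (W : lmodType k) (F : K -> K -> W) a : bilin F ->
  tlift F (comul (pi a)) = tlift (fun a1 a2 => F (pi a1) (pi a2)) (comul a).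
Proof.
move=> hF; case: (hcross_hom hpi) => _ -> _.
rewrite (linear_tlift _ _ (tlift_linear hF)).
by apply: eq_tlift => x y; rewrite (tlift_tens _ _ hF).
Qed.

Lemma conv_pi_inv a : (pi \* sigma) a = counit a *: 1.
Proof.
have [_ _ <-] := hcross_hom hpi; rewrite -antipoder tlift_comul_pi //.
exact: mul_antipode_bilin.
Qed.

Lemma conv_inv_pi a : (sigma \* pi) a = counit a *: 1.
Proof.
have [_ _ <-] := hcross_hom hpi; rewrite -antipodel tlift_comul_pi //.
exact: antipode_mul_bilin.
Qed.

Lemma orb_mul x y a : act a (x * y) = (orb x \* orb y) a.
Proof. exact: mactM. Qed.

Lemma pi_mul a b : pi (a * b) = (pi \* orb (pi b)) a.
Proof. exact: hcrossE. Qed.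

Let mconvA (f g h : H -> K) a : linear f -> linear g -> linear h ->
  (f \* g \* h) a = (f \* (g \* h)) a.
Proof. by move=> *; apply: convA => // *; rewrite mulrA. Qed.

(** By definition the action [a2 ⇀ x] uses the factor after the two that come from
    the coproduct of [pi a1]; cocommutativity moves it between them, in the order of
    the product. *)
Lemma derived_actE a x : derived_act act pi a x = (pi \* orb x \* sigma) a.
Proof.
have e : forall a1 a2, ad (pi a1) (act a2 x) =
    tlift (fun b1 b2 => pi b1 * act a2 x * sigma b2) (comul a1).
  move=> a1 a2; rewrite /ad tlift_comul_pi //.
  by apply: (bilin_comp mb); [exact: mb.1 | exact: antipode_linear].
rewrite /derived_act (eq_tlift _ e).
rewrite (sweedler_rotate cocomH (F := fun x1 x2 z => pi x1 * act z x * sigma x2)).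
- by apply: eq_tlift => u y; rewrite -(linear_tlift _ _ (mb.1 _)).
- move=> z; apply: (bilin_comp mb) => //.
  exact: linear_comp (mb.1 _) pil.
- move=> x1; split=> [z|x2].
    exact: linear_comp (mb.2 _) sl.
  exact: linear_comp (mb.1 _) (linear_comp (mb.2 _) (actl x)).
- move=> x2; split=> [z|x1].
    exact: linear_comp (mb.1 _) (linear_comp (mb.1 _) pil).
  exact: linear_comp (mb.1 _) (linear_comp (mb.2 _) (actl x)).
Qed.

Lemma derived_bilin : bilin (derived_act act pi).
Proof.
split=> [x|a] c y z; rewrite !derived_actE.
  exact: (convl (convl pil (actl x)) sl).
suff actl' : linear (fun x => (pi \* orb x \* sigma) a) by exact: actl'.
rewrite /conv; apply: tlift_values_linear => a1 a2.
apply: linear_comp (mb.1 _) _.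
apply: tlift_values_linear => b1 b2.
exact: linear_comp (mb.2 _) (actr b2).
Qed.

Lemma derived1 x : derived_act act pi 1 x = x.
Proof.
have g1 := @glike_one_subproof k H.
rewrite derived_actE !conv_glike // ?(mact_one hact) //; last exact: convl.
have := conv_pi_inv 1; rewrite conv_glike // counit1 scale1r (hcross1 hact hpi).
by rewrite !mul1r => ->; rewrite mulr1.
Qed.

Lemma derived_one a : derived_act act pi a 1 = (counit a)%:A.
Proof.
rewrite derived_actE -conv_pi_inv; apply: eq_conv => // {}a.
rewrite -[RHS](conv_counitr (m := *%R) (e := 1) a mb pil) //; last exact: mulr1.
by apply: eq_conv => // b; rewrite (mact1 hact).
Qed.

(** The product (π * f_x * σ) * (π * f_y * σ) contains σ * π, which is the unit,
    and f_x * f_y = f_{xy}. *)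
Lemma derivedM a x y : derived_act act pi a (x * y) =
  tlift (fun a1 a2 => derived_act act pi a1 x * derived_act act pi a2 y) (comul a).
Proof.
transitivity ((pi \* orb x \* sigma \* (pi \* orb y \* sigma)) a); last first.
  by apply: eq_tlift => b c; rewrite !derived_actE.
have px := convl pil (actl x); have py := convl pil (actl y).
have cancel b : (sigma \* (pi \* orb y \* sigma)) b = (orb y \* sigma) b.
  rewrite -mconvA //; apply: eq_conv => // {}b.
  rewrite -mconvA // -[RHS](conv_counitl (m := *%R) (e := 1) b mb (actl y) (@mul1r K)).
  by apply: eq_conv => // c; rewrite conv_inv_pi.
rewrite derived_actE; apply: esym; rewrite mconvA //; last exact: convl.
transitivity ((pi \* orb x \* (orb y \* sigma)) a); first exact: eq_conv.
rewrite -mconvA //; apply: eq_conv => // b; rewrite mconvA //.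
by apply: eq_conv => // c; rewrite orb_mul.
Qed.

Lemma counit_convl (f g : H -> K) a : linear g ->
  (forall b, counit (f b) = counit b) -> counit ((f \* g) a) = counit (g a).
Proof.
move=> hg hf; have kl : linear (@counit k K : K -> k^o) := @counit_linear k K.
rewrite -[in RHS](counitl a) (linear_tlift _ _ (linear_comp kl hg)).
rewrite [LHS](linear_tlift _ _ kl); apply: (@eq_tlift _ _ _ k^o) => x y.
by rewrite counitM hf [RHS](linear_scaleE (linear_comp kl hg)).
Qed.

Lemma counit_convr (f g : H -> K) a : linear f ->
  (forall b, counit (g b) = counit b) -> counit ((f \* g) a) = counit (f a).
Proof.
move=> hf hg; have kl : linear (@counit k K : K -> k^o) := @counit_linear k K.
rewrite -[in RHS](counitr a) (linear_tlift _ _ (linear_comp kl hf)).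
rewrite [LHS](linear_tlift _ _ kl); apply: (@eq_tlift _ _ _ k^o) => x y.
by rewrite counitM hg mulrC [RHS](linear_scaleE (linear_comp kl hf)).
Qed.

Let counit_pi a : counit (pi a) = counit a.
Proof. by case: (hcross_hom hpi). Qed.

Lemma counit_cross_inv a : counit (sigma a) = counit a.
Proof.
have kl : linear (@counit k K : K -> k^o) := @counit_linear k K.
rewrite -(counit_convl a sl counit_pi) conv_pi_inv.
by rewrite [LHS](linear_scaleE kl) counit1; apply: mulr1.
Qed.

Lemma derived_counit a x : counit (derived_act act pi a x) = counit a * counit x.
Proof.
have px := convl pil (actl x).
rewrite derived_actE (counit_convr _ px counit_cross_inv).
by rewrite (counit_convl _ (actl x) counit_pi) (mact_counit hact).
Qed.

Lemma comul_conv (f g : H -> K) a :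
  comul ((f \* g) a)
  = conv (@tmul k K K) (fun b => comul (f b)) (fun b => comul (g b)) a.
Proof.
rewrite (linear_tlift _ _ (@comul_linear k K)).
by apply: eq_tlift => x y; rewrite comulM.
Qed.

Lemma conv_tens_mul (f g f' g' : H -> K) a :
  linear f -> linear g -> linear f' -> linear g' ->
  conv (@tmul k K K) (conv (@tens k K K) f g) (conv (@tens k K K) f' g') a
  = conv (@tens k K K) (f \* f') (g \* g') a.
Proof. by move=> *; apply: convACA => // *; rewrite tmul_tens. Qed.

Lemma comul_pi a : comul (pi a) = conv (@tens k K K) pi pi a.
Proof. by have [_ -> _] := hcross_hom hpi. Qed.

(** Both sides are convolution inverse to Δ ∘ π in Hom(H, K ⊗ K): the left one
    because Δ is multiplicative, the right one by the middle four interchange,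
    which needs H cocommutative. *)
Lemma comul_cross_inv a : comul (sigma a) = conv (@tens k K K) sigma sigma a.
Proof.
have cl := @comul_linear k K; have ss := conv_linear tb sl sl.
have pp := conv_linear tb pil pil.
apply: (conv_inv_unique (m := @tmul k K K) (e := 1 ⊗ 1) (g := fun b => comul (pi b))
  (f := fun b => comul (sigma b))) => {a} //.
- exact: tmulA.
- exact: tmul1.
- exact: tmulr1.
- exact: linear_comp.
- exact: linear_comp.
- move=> a; rewrite -comul_conv conv_inv_pi.
  by rewrite (linear_scaleE cl) comul1.
move=> a.
rewrite (eq_conv (m' := @tmul k K K) (f' := conv (@tens k K K) pi pi)
  (g' := conv (@tens k K K) sigma sigma)) //; last exact: comul_pi.
rewrite conv_tens_mul //.
rewrite (eq_conv (m' := @tens k K K) (f' := fun b => counit b *: 1)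
  (g' := fun b => counit b *: 1)) //; try exact: conv_pi_inv.
(* It remains to see that a |-> ε(a_1) 1 ⊗ ε(a_2) 1 is the unit a |-> ε(a) 1 ⊗ 1. *)
rewrite -(bilinZr tb) -[in RHS](conv_counitl (m := *%R) a mb unitl (@mul1r K)).
rewrite (linear_tlift _ _ (tb.2 1)); apply: eq_tlift => x y.
by rewrite (bilinZl tb) -(bilinZr tb) mulr_algl.
Qed.

Lemma derived_comul a x : comul (derived_act act pi a x) =
  tlift (fun a1 a2 => tlift (fun x1 x2 =>
    derived_act act pi a1 x1 ⊗ derived_act act pi a2 x2) (comul x)) (comul a).
Proof.
have comul_orb b : comul (act b x)
    = tlift (fun x1 x2 => conv (@tens k K K) (orb x1) (orb x2) b) (comul x).
  by rewrite (mact_comul hact) tlift_exchange.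
rewrite tlift_exchange derived_actE comul_conv.
transitivity (conv (@tmul k K K)
   (fun b => tlift (fun x1 x2 => conv (@tmul k K K) (conv (@tens k K K) pi pi)
                       (conv (@tens k K K) (orb x1) (orb x2)) b) (comul x))
   (conv (@tens k K K) sigma sigma) a).
  apply: eq_conv => // b; last exact: comul_cross_inv.
  rewrite comul_conv -conv_tliftr //; apply: eq_conv => // c; exact: comul_pi.
rewrite conv_tliftl //; apply: eq_tlift => x1 x2.
have px1 := convl pil (actl x1); have px2 := convl pil (actl x2).
transitivity (conv (@tens k K K) (pi \* orb x1 \* sigma) (pi \* orb x2 \* sigma) a).
  rewrite -conv_tens_mul //; apply: eq_conv => // b; exact: conv_tens_mul.
by apply: eq_tlift => a1 a2; rewrite !derived_actE.
Qed.

Lemma conv_orb_mul y z a : (pi \* orb y \* orb z) a = (pi \* orb (y * z)) a.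
Proof. by rewrite mconvA //; apply: eq_conv => // b; rewrite orb_mul. Qed.

(** The absorption rule behind [cross_inv_mul] and [derived_comp]: the two orbit maps
    merge, and the result is linear in the product [y * z]. *)
Lemma derived_act_mul y z a :
  (pi \* orb y \* (orb z \* sigma)) a = derived_act act pi a (y * z).
Proof.
rewrite derived_actE -mconvA //; last exact: convl.
by apply: eq_conv => // b; apply: conv_orb_mul.
Qed.

Lemma conv_pi_orb_linear a : linear (fun y => (pi \* orb y) a).
Proof.
rewrite /conv; apply: tlift_values_linear => b1 b2.
exact: linear_comp (mb.2 _) (actr b2).
Qed.

(** Both sides, as functions of (a, b), are convolution inverse to (a, b) |-> π(ab)
    in Hom(H ⊗ H, K).  The left side is a left inverse by evaluating σ * π at ab.
    The right side is a right inverse because, by [derived_act_mul], the product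
    collapses to a ⇀_π (π * σ)(b) = ε(b) (a ⇀_π 1).  The convolution over a is
    [conv], and that over b is written out as a Sweedler sum. *)
Lemma cross_inv_mul a b : sigma (a * b) = (orb (sigma b) \* sigma) a.
Proof.
have pib c := linear_comp pil (mulbl c); have sib c := linear_comp sl (mulbl c).
pose s' c := orb (sigma c) \* sigma.
have s'l c : linear (s' c) := convl (actl (sigma c)) sl.
have s'r c : linear (fun b => s' b c).
  rewrite /s' /conv; apply: tlift_values_linear => a1 a2.
  exact: linear_comp (mb.1 _) (linear_comp (actr a1) sl).
have linv v c : tlift (fun b1 b2 =>
    ((fun x => sigma (x * b1)) \* (fun x => pi (x * b2))) c) (comul v)
    = counit v *: (counit c *: 1).
  by rewrite -conv_mulr // conv_inv_pi counitM scalerA mulrC.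
have rinv v c : tlift (fun b2 b3 => ((fun x => pi (x * b2)) \* s' b3) c) (comul v)
    = counit v *: (counit c *: 1).
  rewrite -derived_one -(linear_scaleE (derived_bilin.2 c)) -conv_pi_inv.
  rewrite (linear_conv _ _ _ _ (derived_bilin.2 c)); apply: eq_tlift => b2 b3.
  rewrite -derived_act_mul; apply: eq_conv => // d; exact: pi_mul.
(* Uniqueness of inverses: the triple product (left inverse)(π)(right inverse) is
   evaluated with both bracketings of the three copies of [b]. *)
transitivity (tlift (fun b1 v => tlift (fun b2 b3 =>
    ((fun x => sigma (x * b1)) \* ((fun x => pi (x * b2)) \* s' b3)) a)
  (comul v)) (comul b)).
  have sa : linear (fun b => sigma (a * b)).
    exact: linear_comp sl ((@mul_bilin k H).2 a).
  rewrite -[in LHS](counitr b) (linear_tlift _ _ sa).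
  apply: eq_tlift => b1 v; rewrite (linear_scaleE sa) -conv_tliftr //.
  rewrite -(conv_counitr (m := *%R) (e := 1) a mb (sib b1)) ?mulr1 //; last exact: mulr1.
  rewrite /conv /tlift scaler_sumr; apply: eq_bigr => p _.
  by rewrite scalerAr; congr (_ * _); apply/esym/rinv.
rewrite -(sweedlerA (F := fun b1 b2 b3 => ((fun x => sigma (x * b1))
    \* ((fun x => pi (x * b2)) \* s' b3)) a)).
- rewrite -[RHS]/(s' b a) -[in RHS](counitl b).
  rewrite (linear_tlift _ _ (s'r a)); apply: eq_tlift => u b3.
  rewrite (linear_scaleE (s'r a)) -(conv_counitl (m := *%R) (e := 1) a mb (s'l b3)
    (@mul1r K)).
  transitivity (((fun c => tlift (fun b1 b2 =>
    ((fun x => sigma (x * b1)) \* (fun x => pi (x * b2))) c) (comul u)) \* s' b3) a).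
    rewrite conv_tliftl //; apply: eq_tlift => b1 b2; apply: esym; exact: mconvA.
  rewrite /conv /tlift scaler_sumr; apply: eq_bigr => p _.
  by rewrite scalerAl; congr (_ * _); apply: linv.
- move=> b3; split=> [b2|b1]; rewrite /conv; apply: tlift_values_linear => a1 a2.
    exact: linear_comp (mb.1 _) (linear_comp sl ((@mul_bilin k H).2 a1)).
  apply: linear_comp (mb.2 _) _; apply: tlift_values_linear => a3 a4.
  exact: linear_comp (mb.1 _) (linear_comp pil ((@mul_bilin k H).2 a3)).
move=> b1; split=> [b3|b2]; rewrite /conv; apply: tlift_values_linear => a1 a2;
  apply: linear_comp (mb.2 _) _; apply: tlift_values_linear => a3 a4.
  exact: linear_comp (mb.1 _) (linear_comp pil ((@mul_bilin k H).2 a3)).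
exact: linear_comp (mb.2 _) (s'r a4).
Qed.

(** The expansion of π * f_x * σ at ab by the rules for π(ab) and σ(ab), with the
    part π * f_x treated separately in [pixM]. *)
Lemma derived_comp a b x :
  derived_act act pi (a * b) x = derived_act act pi a (derived_act act pi b x).
Proof.
have pib c := linear_comp pil (mulbl c); have sib c := linear_comp sl (mulbl c).
have pxl := convl pil (actl x).
have pixM c u : (pi \* orb x) (c * u) = (pi \* orb ((pi \* orb x) u)) c.
  rewrite conv_mulr // (linear_conv _ _ _ _ (conv_pi_orb_linear c)).
  apply: eq_tlift => b1 b2; rewrite -conv_orb_mul; apply: eq_conv => // d.
    exact: pi_mul.
  exact: mact_comp.
rewrite [LHS]derived_actE conv_mulr // [derived_act _ _ b x]derived_actE.
rewrite (linear_conv _ _ _ _ (derived_bilin.2 a)); apply: eq_tlift => u b3.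
rewrite -derived_act_mul; apply: eq_conv => // c.
exact: cross_inv_mul.
Qed.

Lemma derived_module : module_bialgebra (derived_act act pi).
Proof.
split.
- exact: derived_bilin.
- exact: derived1.
- exact: derived_comp.
- exact: derived_one.
- exact: derivedM.
- exact: derived_counit.
- exact: derived_comul.
Qed.
End Derived.

(** * Restriction to primitive and group-like elements *)

Theorem corollary4p6 (k : fieldType) (char0 : [pchar k] =i pred0)
    (H K : hopfType k) (cocomH : cocommutative H)
    (act : H -> K -> K) (hact : module_bialgebra act)
    (pi : H -> K) (hpi : hopf_crossed_hom act pi) :
  exists hder : module_bialgebra (derived_act act pi),
    (forall (a : primitive H) (x : primitive K),
       derived_act act pi (prim_val a) (prim_val x)
         = commutator (pi (prim_val a)) (prim_val x) + act (prim_val a) (prim_val x)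
       /\ prim_act hder a x = lie_derived (prim_hom hact hpi) a x)
    /\
    (forall (a : grouplike H) (x : grouplike K),
       derived_act act pi (glike_val a) (glike_val x)
         = pi (glike_val a) * act (glike_val a) (glike_val x)
           * glike_val ((glike_hom hact hpi a)^-1)%g
       /\ glike_act hder a x = grp_derived (glike_hom hact hpi) a x).
Proof.
exists (derived_module cocomH hact hpi).
have pil : linear pi by case: (hcross_hom hpi).
have mb := @mul_bilin k K.
have actl y : linear (act^~ y) := (mact_bilin hact).1 y.
have sl : linear (cross_inv pi) := linear_comp (@antipode_linear k K) pil.
have pxl y : linear (conv *%R pi (act^~ y)) by apply: conv_linear.
split=> a x.
  have e : derived_act act pi (prim_val a) (prim_val x)
      = commutator (pi (prim_val a)) (prim_val x) + act (prim_val a) (prim_val x).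
    have pa := pi_prim_subproof hact hpi a.
    case: a pa => a /= ha pa; rewrite (derived_actE cocomH hact hpi).
    rewrite conv_prim // conv_prim // (conv_glike _ _ _ (glike_one_subproof H)) //.
    rewrite /cross_inv (hcross1 hact hpi) antipode1 antipode_prim //.
    by rewrite !(mact_one hact) !mul1r mulr1 mulrN addrAC.
  by split=> //; apply: val_inj; rewrite /= e addrC.
have e : derived_act act pi (glike_val a) (glike_val x)
    = pi (glike_val a) * act (glike_val a) (glike_val x)
      * glike_val ((glike_hom hact hpi a)^-1)%g.
  case: a => a ha /=; rewrite (derived_actE cocomH hact hpi).
  by rewrite !conv_glike.
by split=> //; apply: val_inj.
Qed.
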